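(* Let $(F_n)_{n\ge1}$ be the Fibonacci numbers $F_1=1$, $F_2=2$, $F_n=F_{n-1}+F_{n-2}$ for $n\ge3$. For each of the following sets $P$ of five generalized patterns, $|S_n(P)|=F_n$ for every $n\ge1$: $\{1\text{-}23,2\text{-}13,1\text{-}32,21\text{-}3,12\text{-}3\}$, $\{1\text{-}23,2\text{-}13,13\text{-}2,21\text{-}3,12\text{-}3\}$, $\{1\text{-}23,2\text{-}13,13\text{-}2,1\text{-}32,21\text{-}3\}$, $\{1\text{-}23,13\text{-}2,31\text{-}2,3\text{-}12,1\text{-}32\}$.
   Context: $S_n$ is the set of permutations $\pi=\pi_1\pi_2\cdots\pi_n$ of $\{1,\dots,n\}$. For $abc$ a permutation of $123$, the generalized pattern $a\text{-}bc$ is contained in $\pi$ if there are indices $i<j$ with $j+1\le n$ such that $\pi_i\pi_j\pi_{j+1}$ is order-isomorphic to $abc$; the generalized pattern $ab\text{-}c$ is contained in $\pi$ if there are indices $i,k$ with $i+1<k\le n$ such that $\pi_i\pi_{i+1}\pi_k$ is order-isomorphic to $abc$. (Letters not separated by a dash must occur in adjacent positions; letters separated by a dash need not be adjacent.) $\pi$ avoids a pattern if it does not contain it. For a set $P$ of generalized patterns, $S_n(P)$ is the set of $\pi\in S_n$ avoiding every pattern in $P$. *)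

(* Defs.v *)
From mathcomp Require Import all_boot all_fingroup.
Set Implicit Arguments.
Unset Strict Implicit.
Unset Printing Implicit Defensive.

(* Two words of distinct letters are order-isomorphic when they have the same
   length and their letters compare in the same way at every two positions. *)
Definition order_iso (u v : seq nat) : bool :=
  (size u == size v) &&
  all (fun i => all (fun j =>
         (nth 0 u i < nth 0 u j) == (nth 0 v i < nth 0 v j))
       (iota 0 (size u))) (iota 0 (size u)).

Inductive dash_position := DashFirst (* a-bc *) | DashSecond (* ab-c *).

Record gpattern := GPattern {
  dash : dash_position;
  word : seq nat;
  word_perm : perm_eq word [:: 1; 2; 3]
}.

Notation "[ 'gp' a '-' b c ]" := (@GPattern DashFirst [:: a; b; c] isT)
  (at level 0, a at level 0, b at level 0, c at level 0,
   format "[ 'gp'  a '-' b  c ]").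
Notation "[ 'gp' a b '-' c ]" := (@GPattern DashSecond [:: a; b; c] isT)
  (at level 0, a at level 0, b at level 0, c at level 0,
   format "[ 'gp'  a  b '-' c ]").

(* Positions and letters are numbered from 0 to n - 1 instead of from 1 to n:
   the letter in position i + 1 of the permutation is [pi i] + 1. *)
Definition contains (n : nat) (pi : 'S_n) (p : gpattern) : bool :=
  [exists i : 'I_n, exists j : 'I_n, exists k : 'I_n,
    match dash p with
    | DashFirst => (i < j) && (k == j.+1 :> nat)
    | DashSecond => (j == i.+1 :> nat) && (j < k)
    end && order_iso [:: pi i : nat; pi j : nat; pi k : nat] (word p)].

Definition avoids (n : nat) (pi : 'S_n) (p : gpattern) : bool :=
  ~~ contains pi p.

(* S_n(P), for P a finite set of patterns given as a list. *)
Definition avoiders (n : nat) (P : seq gpattern) : {set 'S_n} :=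
  [set pi : 'S_n | all (avoids pi) P].

(* Main.v *)
Require Import Defs.
From mathcomp Require Import all_boot all_fingroup.
From mathcomp Require Import zify.

Set Implicit Arguments.
Unset Strict Implicit.
Unset Printing Implicit Defensive.

(** For the first three sets the largest letter can only be in the first or in
    the second position, and in the second case the first letter is the second
    largest one.  The avoiders are therefore obtained exactly once by putting
    either [n] or [n-1, n] in front of a shorter avoider.  For the fourth set
    the smallest letter can only be in the last position or just before the
    last one, and in the second case the last letter is [n]; here one puts [1]
    or [1, n] at the end of a shorter avoider. *)

(** * Counting by inserting letters *)

Lemma lift_perm_inj n (i j : 'I_n.+1) : injective (lift_perm i j).
Proof.
move=> s t st; apply/permP => k; apply: (@lift_inj _ j).
by rewrite -!(lift_perm_lift i) st.
Qed.

(** The preimage [s] is [pi] with position [i] and its letter deleted and the rest renumbered. *)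
Lemma lift_perm_surj n (i j : 'I_n.+1) (pi : 'S_n.+1) :
  pi i = j -> exists s, pi = lift_perm i j s.
Proof.
(* The default [k] is never taken: [pi] is injective and [lift i k] differs from [i]. *)
move=> <-{j}; pose f k := odflt k (unlift (pi i) (pi (lift i k))).
have fE k : lift (pi i) (f k) = pi (lift i k).
  rewrite /f; case: unliftP => [//|/perm_inj ik].
  by have := neq_lift i k; rewrite ik eqxx.
have f_inj : injective f.
  move=> k l fkl; apply: (@lift_inj _ i); apply: (@perm_inj _ pi).
  by rewrite -!fE fkl.
exists (perm f_inj); apply/permP => k; case: (unliftP i k) => [l|] ->.
  by rewrite lift_perm_lift permE fE.
by rewrite lift_perm_id.
Qed.

Lemma card_two_images (T1 T2 T : finType) (f : T1 -> T) (g : T2 -> T)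
    (A : {set T1}) (B : {set T2}) (C : {set T}) :
    injective f -> injective g -> (forall x y, f x <> g y) ->
    (forall x, (f x \in C) = (x \in A)) -> (forall y, (g y \in C) = (y \in B)) ->
    {in C, forall z, (exists x, z = f x) \/ (exists y, z = g y)} ->
  #|C| = #|A| + #|B|.
Proof.
move=> f_inj g_inj fg fC gC CE.
have -> : C = f @: A :|: g @: B.
  apply/setP=> z; rewrite inE; apply/idP/orP => [zC|[]/imsetP[x xAB ->]].
  - have [[x zx]|[y zy]] := CE z zC; [left|right]; apply/imsetP.
      by exists x; rewrite // -fC -zx.
    by exists y; rewrite // -gC -zy.
  - by rewrite fC.
  - by rewrite gC.
rewrite cardsU !card_imset // [_ :&: _](_ : _ = set0) ?cards0 ?subn0 //.
apply/setP=> z; rewrite !inE; apply/negP=> /andP[/imsetP[x _ ->]].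
by case/imsetP=> y _ /fg.
Qed.

(** * Permutations as words *)

(* The value at a position [k >= n] is the junk value [0]. *)
Definition letter n (pi : 'S_n) (k : nat) : nat :=
  if insub k is Some i then pi i else 0.

Lemma letter_ord n (pi : 'S_n) (i : 'I_n) : letter pi i = pi i.
Proof. by rewrite /letter valK. Qed.

Lemma letterE n (pi : 'S_n) k (kn : k < n) : letter pi k = pi (Ordinal kn).
Proof. exact: (letter_ord pi (Ordinal kn)). Qed.

Lemma ltn_letter n (pi : 'S_n) k : k < n -> letter pi k < n.
Proof. by move=> kn; rewrite letterE. Qed.

Lemma letter_inj n (pi : 'S_n) k l :
  k < n -> l < n -> letter pi k = letter pi l -> k = l.
Proof. by move=> kn ln; rewrite !letterE => /val_inj/perm_inj[]. Qed.

Lemma letter_surj n (pi : 'S_n) v : v < n -> exists2 k, k < n & letter pi k = v.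
Proof.
move=> vn; pose i := (pi^-1)%g (Ordinal vn).
by exists i; rewrite ?letter_ord ?permKV.
Qed.

Lemma letter_lift_perm_id n (i j : 'I_n.+1) (s : 'S_n) :
  letter (lift_perm i j s) i = j.
Proof. by rewrite letter_ord lift_perm_id. Qed.

Lemma letter_lift_perm n (i j : 'I_n.+1) (s : 'S_n) k : k < n ->
  letter (lift_perm i j s) (bump i k) = bump j (letter s k).
Proof.
move=> kn; rewrite (letterE s kn) -[bump i k]/(val (lift i (Ordinal kn))).
by rewrite letter_ord lift_perm_lift.
Qed.

(** Positions are plain naturals, so that occurrences can be shifted by arithmetic; the bound on [k]
    is stated separately. *)
Definition occurs (p : gpattern) (w : nat -> nat) (i j k : nat) : bool :=
  match dash p with
  | DashFirst => (i < j) && (k == j.+1)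
  | DashSecond => (j == i.+1) && (j < k)
  end && order_iso [:: w i; w j; w k] (word p).

Lemma occurs_lt p w i j k : occurs p w i j k -> i < j < k.
Proof. by case/andP; case: (dash p); lia. Qed.

Lemma containsP n (pi : 'S_n) p :
  reflect (exists i j k, k < n /\ occurs p (letter pi) i j k) (contains pi p).
Proof.
apply: (iffP existsP) => [[i /existsP[j /existsP[k ijk]]]|[i [j [k [kn ijk]]]]].
  by exists i, j, k; split => //; rewrite /occurs !letter_ord.
have /andP[ij jk] := occurs_lt ijk.
have jn := ltn_trans jk kn; have ni := ltn_trans ij jn.
exists (Ordinal ni); apply/existsP; exists (Ordinal jn); apply/existsP.
by exists (Ordinal kn); move: ijk; rewrite /occurs !letterE.
Qed.

Lemma avoidsN n (pi : 'S_n) p i j k :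
  avoids pi p -> k < n -> occurs p (letter pi) i j k = false.
Proof.
by move=> /negP pip kn; apply/negP => ijk; apply: pip; apply/containsP; exists i, j, k.
Qed.

Lemma order_iso_succ a b c v :
  order_iso [:: a.+1; b.+1; c.+1] v = order_iso [:: a; b; c] v.
Proof. by rewrite /order_iso /= !ltnS. Qed.

Ltac order_iso3 a b c :=
  rewrite /order_iso /= !ltnn; case: (ltngtP a b); case: (ltngtP b c);
  case: (ltngtP a c) => //=; lia.

Lemma order_iso123 a b c : order_iso [:: a; b; c] [:: 1; 2; 3] = (a < b < c).
Proof. order_iso3 a b c. Qed.

Lemma order_iso132 a b c : order_iso [:: a; b; c] [:: 1; 3; 2] = (a < c < b).
Proof. order_iso3 a b c. Qed.

Lemma order_iso213 a b c : order_iso [:: a; b; c] [:: 2; 1; 3] = (b < a < c).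
Proof. order_iso3 a b c. Qed.

Lemma order_iso312 a b c : order_iso [:: a; b; c] [:: 3; 1; 2] = (b < c < a).
Proof. order_iso3 a b c. Qed.

Definition order_isoE := (order_iso123, order_iso132, order_iso213, order_iso312).

(** Shifting positions by [c] preserves adjacency and order, so occurrences in [s] match those in
    [t] that start past the prefix. *)
Lemma contains_prefix c m n (s : 'S_n) (t : 'S_m) p : m = c + n ->
    (forall k, k < n -> letter t (c + k) = letter s k) ->
    (forall i j k, k < m -> occurs p (letter t) i j k -> c <= i) ->
  contains t p = contains s p.
Proof.
move=> mE ts ct; apply/containsP/containsP => [] [i [j [k [kn ijk]]]];
  have lt_ijk := occurs_lt ijk.
  have ci := ct i j k kn ijk; exists (i - c), (j - c), (k - c); split; first by lia.
  move: ijk; rewrite /occurs -!ts; try lia.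
  rewrite !subnKC; try lia.
  by case/andP=> ijk ->; rewrite andbT; move: ijk; case: (dash p); lia.
exists (c + i), (c + j), (c + k); split; first by lia.
move: ijk; rewrite /occurs !ts; try lia.
by case/andP=> ijk ->; rewrite andbT; move: ijk; case: (dash p); lia.
Qed.

Lemma contains_suffix m n (s : 'S_n) (t : 'S_m) p : n <= m ->
    (forall k, k < n -> letter t k = (letter s k).+1) ->
    (forall i j k, k < m -> occurs p (letter t) i j k -> k < n) ->
  contains t p = contains s p.
Proof.
move=> nm ts tn; apply/containsP/containsP => [] [i [j [k [km ijk]]]];
  have /andP[ij jk] := occurs_lt ijk.
  have kn := tn i j k km ijk; exists i, j, k; split => //.
  by move: ijk; rewrite /occurs !ts ?order_iso_succ //; lia.
exists i, j, k; split; first by lia.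
by move: ijk; rewrite /occurs !ts ?order_iso_succ //; lia.
Qed.

(** An occurrence needs three positions, so every permutation of size 0 or 1 is an avoider. *)
Lemma card_avoiders_le1 n P : n <= 1 -> #|avoiders n P| = 1.
Proof.
move=> n1; rewrite (_ : avoiders n P = setT); last first.
  apply/setP=> pi; rewrite !inE; elim: P => //= p P ->; rewrite andbT.
  by apply/containsP => -[i [j [k [kn /occurs_lt]]]]; lia.
by rewrite cardsT card_Sn; case: n n1 => [|[]].
Qed.

Lemma eq_avoiders m n (t : 'S_m) (s : 'S_n) (a : pred gpattern) P : all a P ->
    (forall p, a p -> contains t p = contains s p) ->
  (t \in avoiders m P) = (s \in avoiders n P).
Proof.
move=> aP tsP; rewrite !inE; elim: P aP => //= p P IH /andP[ap aP].
by rewrite (IH aP) /avoids tsP.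
Qed.

(** * Largest letters in front *)

Definition add_max n (s : 'S_n) : 'S_n.+1 := lift_perm ord0 ord_max s.

(** The letter [n] goes in front first; [lift ord0 ord0] is position 1, where [n.+1] is then
    inserted. *)
Definition add_max2 n (s : 'S_n) : 'S_n.+2 :=
  lift_perm (lift ord0 ord0) ord_max (add_max s).

Lemma letter_add_max0 n (s : 'S_n) : letter (add_max s) 0 = n.
Proof. exact: (letter_lift_perm_id ord0 ord_max s). Qed.

Lemma letter_add_maxS n (s : 'S_n) k :
  k < n -> letter (add_max s) k.+1 = letter s k.
Proof.
move=> kn; have := letter_lift_perm ord0 ord_max s kn.
by rewrite /bump /= => ->; have := ltn_letter s kn; lia.
Qed.

Lemma letter_add_max2_0 n (s : 'S_n) : letter (add_max2 s) 0 = n.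
Proof.
have := letter_lift_perm (lift ord0 ord0) ord_max (add_max s) (ltn0Sn n).
by rewrite letter_add_max0 /bump /= ltnn => ->.
Qed.

Lemma letter_add_max2_1 n (s : 'S_n) : letter (add_max2 s) 1 = n.+1.
Proof. exact: (letter_lift_perm_id (lift ord0 ord0) ord_max (add_max s)). Qed.

Lemma letter_add_max2_SS n (s : 'S_n) k :
  k < n -> letter (add_max2 s) k.+2 = letter s k.
Proof.
move=> kn; have k1n : k.+1 < n.+1 by [].
have := letter_lift_perm (lift ord0 ord0) ord_max (add_max s) k1n.
rewrite letter_add_maxS // /bump /= => ->.
by have := ltn_letter s kn; lia.
Qed.

(** These are exactly the permutations of 123 whose last letter exceeds the first. *)
Definition reverse_layered_words := [:: [:: 1; 2; 3]; [:: 1; 3; 2]; [:: 2; 1; 3]].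

Lemma contains_add_max n (s : 'S_n) p : word p \in reverse_layered_words ->
  contains (add_max s) p = contains s p.
Proof.
move=> wp; apply: (@contains_prefix 1) => [//||i j k kn ijk].
  exact: letter_add_maxS.
have lt_ijk := occurs_lt ijk; case: i ijk lt_ijk => // /andP[_ ijk] lt_ijk.
have jn : j < n.+1 by lia.
have := ltn_letter (add_max s) jn; have := ltn_letter (add_max s) kn.
move: ijk; rewrite letter_add_max0; move: wp; rewrite !inE.
by case/or3P=> /eqP ->; rewrite order_isoE; lia.
Qed.

(** The last letter of an occurrence exceeds its first. Nothing exceeds [n.+1], and only [n.+1]
    exceeds [n]; but it stands at position 1, while [k] is at least 2. *)
Lemma contains_add_max2 n (s : 'S_n) p : word p \in reverse_layered_words ->
  contains (add_max2 s) p = contains s p.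
Proof.
move=> wp; apply: (@contains_prefix 2) => [//||i j k kn ijk].
  exact: letter_add_max2_SS.
have lt_ijk := occurs_lt ijk; rewrite leqNgt; apply/negP => i2.
case/andP: ijk => _ ijk; have jn : j < n.+2 by lia.
have := ltn_letter (add_max2 s) jn; have := ltn_letter (add_max2 s) kn.
have k1 : letter (add_max2 s) k <> n.+1.
  move=> kE; have := @letter_inj _ (add_max2 s) k 1 kn isT.
  by rewrite kE letter_add_max2_1 => /(_ erefl); lia.
have [i0|i1] : i = 0 \/ i = 1 by lia.
  move: ijk k1; rewrite i0 letter_add_max2_0; move: wp; rewrite !inE.
  by case/or3P=> /eqP ->; rewrite order_isoE; lia.
move: ijk; rewrite i1 letter_add_max2_1; move: wp; rewrite !inE.
by case/or3P=> /eqP ->; rewrite order_isoE; lia.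
Qed.

Lemma avoids_max_first n (pi : 'S_n.+2) :
    avoids pi [gp 1-2 3] -> avoids pi [gp 2-1 3] ->
    avoids pi [gp 1-3 2] || avoids pi [gp 1 3-2] ->
  letter pi 0 = n.+1 \/ letter pi 0 = n /\ letter pi 1 = n.+1.
Proof.
move=> p123 p213 p132.
have [q qn qmax] := letter_surj pi (ltnSn n.+1).
have lt_pi k : k < n.+2 -> k <> q -> letter pi k < n.+1.
  move=> kn kq; have := ltn_letter pi kn; rewrite ltnS leq_eqVlt.
  by case/predU1P=> // kmax; case: kq; apply: (@letter_inj _ pi _ _ kn qn); rewrite kmax qmax.
(* Such an ascent forms 1-23 or 2-13 with the first letter, according to whether its lower letter is
   above or below that one. Hence the maximum is at position 0 or 1. *)
have no_rise k : 1 < k < n.+2 -> letter pi k.-1 < letter pi k ->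
    letter pi 0 < letter pi k -> False.
  move=> /andP[k1 kn] hk h0.
  have := avoidsN 0 k.-1 p123 kn; have := avoidsN 0 k.-1 p213 kn.
  rewrite /occurs /= !order_isoE.
  have k0 : letter pi k.-1 <> letter pi 0 by move/letter_inj; lia.
  by lia.
have [q0|[q1|q2]] : q = 0 \/ q = 1 \/ 1 < q by lia.
- by left; rewrite -q0.
- right; rewrite -q1 qmax; split => //.
  have [r rn rn1] := letter_surj pi (ltnW (ltnSn n.+1)).
  have [r0|r0] : r = 0 \/ 0 < r by lia.
    by move: rn1; rewrite r0.
  have r1 : r <> q by move=> rq; move: qmax; rewrite -rq rn1; lia.
  have l0 : letter pi 0 < n.
    have : letter pi 0 <> letter pi r by move/letter_inj; lia.
    by have := lt_pi 0; lia.
  (* Suppose [n] is at [r], beyond the maximum. Positions 0, 1, [r] form 13-2, and also 1-32 if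
     [r = 2]; for larger [r] the letter before [n] is smaller, against [no_rise]. *)
  case/orP: p132 => p132; last first.
    have := avoidsN 0 1 p132 rn; rewrite /occurs /= order_isoE -q1 qmax rn1.
    by lia.
  have [r2|r2] : r = 2 \/ 2 < r by lia.
    have := avoidsN 0 1 p132 rn; rewrite /occurs /= order_isoE -q1 qmax rn1.
    by lia.
  case: (no_rise r); rewrite ?rn1 //; first by lia.
  have : letter pi r.-1 <> letter pi r by move/letter_inj; lia.
  by have := lt_pi r.-1; lia.
- case: (no_rise q); rewrite ?q2 ?qmax //; apply: lt_pi; lia.
Qed.

Lemma card_avoiders_max P n :
    all (fun p => word p \in reverse_layered_words) P ->
    (forall pi : 'S_n.+2, all (avoids pi) P ->
       [/\ avoids pi [gp 1-2 3], avoids pi [gp 2-1 3]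
         & avoids pi [gp 1-3 2] || avoids pi [gp 1 3-2]]) ->
  #|avoiders n.+2 P| = #|avoiders n.+1 P| + #|avoiders n P|.
Proof.
move=> wP avP; apply: (@card_two_images _ _ _ (@add_max n.+1) (@add_max2 n)).
- exact: lift_perm_inj.
- by move=> s t /lift_perm_inj/lift_perm_inj.
(* The two images are told apart by their first letter, [n.+1] or [n]. *)
- move=> s t st; have := letter_add_max0 s.
  by rewrite st letter_add_max2_0; lia.
- by move=> s; apply: (eq_avoiders wP) => p; apply: contains_add_max.
- by move=> s; apply: (eq_avoiders wP) => p; apply: contains_add_max2.
move=> pi; rewrite inE => /avP[p123 p213 p132].
have [l0|[l0 l1]] := avoids_max_first p123 p213 p132; [left|right].
  apply: lift_perm_surj; apply: val_inj.
  by rewrite /= -letter_ord.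
have [|s sE] := @lift_perm_surj _ (lift ord0 ord0) ord_max pi.
  by apply: val_inj; rewrite /= -letter_ord.
(* Once [n.+1] is removed from position 1, the first letter [n] is the maximum of what remains. *)
have [|t tE] := @lift_perm_surj _ ord0 ord_max s; last by exists t; rewrite sE tE.
apply: val_inj => /=; rewrite -letter_ord.
have := letter_lift_perm (lift ord0 ord0) ord_max s (ltn0Sn n).
rewrite -sE {1}/bump /= l0; have := ltn_letter s (ltn0Sn n); rewrite /bump.
by lia.
Qed.

(** * Smallest letter at the end *)

Definition add_min n (s : 'S_n) : 'S_n.+1 := lift_perm ord_max ord0 s.

Definition add_min_max n (s : 'S_n) : 'S_n.+2 :=
  lift_perm ord_max ord_max (add_min s).

Lemma letter_add_min_lt n (s : 'S_n) k :
  k < n -> letter (add_min s) k = (letter s k).+1.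
Proof.
move=> kn; have := letter_lift_perm ord_max ord0 s kn.
by rewrite /bump /= leqNgt kn.
Qed.

Lemma letter_add_min_last n (s : 'S_n) : letter (add_min s) n = 0.
Proof. exact: (letter_lift_perm_id ord_max ord0 s). Qed.

Lemma letter_add_min_max n (s : 'S_n) k :
  k < n.+1 -> letter (add_min_max s) k = letter (add_min s) k.
Proof.
move=> kn; have := letter_lift_perm ord_max ord_max (add_min s) kn.
by rewrite /bump /= !(leqNgt n.+1) kn ltn_letter.
Qed.

Lemma letter_add_min_max_last n (s : 'S_n) : letter (add_min_max s) n.+1 = n.+1.
Proof. exact: (letter_lift_perm_id ord_max ord_max (add_min s)). Qed.

(** These are the five patterns of the fourth set. The pattern 12-3 must stay out: an appended
    maximum could serve as its 3. *)
Definition min_max_pattern (p : gpattern) : bool :=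
  match dash p with
  | DashFirst => word p \in [:: [:: 1; 2; 3]; [:: 1; 3; 2]; [:: 3; 1; 2]]
  | DashSecond => word p \in [:: [:: 1; 3; 2]; [:: 3; 1; 2]]
  end.

(** The last letter is never the smallest, so it cannot be an appended 0. It is the largest only in
    1-23, where its neighbour is positive, so it cannot be a maximum just after a 0. *)
Lemma min_max_pattern_last p w i j k : min_max_pattern p -> occurs p w i j k ->
  0 < w k /\ (k = j.+1 /\ 0 < w j \/ w k < maxn (w i) (w j)).
Proof.
rewrite /min_max_pattern /occurs.
by case: (dash p); rewrite !inE;
  [case/or3P=> /eqP -> | case/orP=> /eqP ->]; rewrite order_isoE; lia.
Qed.

Lemma contains_add_min n (s : 'S_n) p : min_max_pattern p ->
  contains (add_min s) p = contains s p.
Proof.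
move=> mp; apply: contains_suffix => [//|k kn|i j k kn ijk].
  exact: letter_add_min_lt.
have [wk _] := min_max_pattern_last mp ijk; rewrite ltn_neqAle -ltnS kn andbT.
by apply: contraTneq wk => ->; rewrite letter_add_min_last.
Qed.

Lemma contains_add_min_max n (s : 'S_n) p : min_max_pattern p ->
  contains (add_min_max s) p = contains s p.
Proof.
move=> mp; apply: contains_suffix => [|k kn|i j k kn ijk]; first by lia.
  by rewrite letter_add_min_max ?letter_add_min_lt //; lia.
have lt_ijk := occurs_lt ijk; have [wk wij] := min_max_pattern_last mp ijk.
have letter_n : letter (add_min_max s) n = 0.
  by rewrite letter_add_min_max ?letter_add_min_last.
have kn0 : k <> n by move=> kE; move: wk; rewrite kE letter_n.
suff : k <> n.+1 by lia.
move=> kE; have ni : i < n.+2 by lia.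
have jn : j < n.+2 by lia.
move: wij; rewrite kE letter_add_min_max_last => -[[[<-]]|].
  by rewrite letter_n.
by have := ltn_letter (add_min_max s) ni; have := ltn_letter (add_min_max s) jn; lia.
Qed.

(** A 0 followed by at least two letters forms 1-23 or 1-32 with the next two. If exactly one letter
    follows it, a maximum placed earlier would form 3-12 with the last two letters. *)
Lemma avoids_min_last n (pi : 'S_n.+2) :
    avoids pi [gp 1-2 3] -> avoids pi [gp 1-3 2] -> avoids pi [gp 3-1 2] ->
  letter pi n.+1 = 0 \/ letter pi n = 0 /\ letter pi n.+1 = n.+1.
Proof.
move=> p123 p132 p312.
have [q qn qmin] := letter_surj pi (ltn0Sn n.+1).
have gt_pi k : k < n.+2 -> k <> q -> 0 < letter pi k.
  move=> kn kq; rewrite lt0n; apply/eqP => k0; case: kq.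
  by apply: (@letter_inj _ pi _ _ kn qn); rewrite k0 qmin.
have [q0|[q1|q2]] : q = n.+1 \/ q = n \/ q.+2 < n.+2 by lia.
- by left; move: qmin; rewrite q0.
- have ln0 : letter pi n = 0 by move: qmin; rewrite q1.
  right; split => //.
  have [r rn rmax] := letter_surj pi (ltnSn n.+1).
  have [r1|r1] : r = n.+1 \/ r < n.+1 by lia.
    by move: rmax; rewrite r1.
  have rq : r <> q by move=> rq; move: rmax; rewrite rq qmin.
  have := avoidsN r n p312 (ltnSn n.+1).
  have := gt_pi n.+1; have := ltn_letter pi (ltnSn n.+1).
  have : letter pi n.+1 <> letter pi r by move/letter_inj; lia.
  by rewrite /occurs /= order_isoE ln0 rmax; lia.
- have := avoidsN q q.+1 p123 q2; have := avoidsN q q.+1 p132 q2.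
  rewrite /occurs /= !order_isoE qmin.
  have : letter pi q.+1 <> letter pi q.+2 by move/letter_inj; lia.
  by have := gt_pi q.+1; have := gt_pi q.+2; lia.
Qed.

Lemma card_avoiders_min P n :
    all min_max_pattern P ->
    (forall pi : 'S_n.+2, all (avoids pi) P ->
       [/\ avoids pi [gp 1-2 3], avoids pi [gp 1-3 2] & avoids pi [gp 3-1 2]]) ->
  #|avoiders n.+2 P| = #|avoiders n.+1 P| + #|avoiders n P|.
Proof.
move=> mP avP; apply: (@card_two_images _ _ _ (@add_min n.+1) (@add_min_max n)).
- exact: lift_perm_inj.
- by move=> s t /lift_perm_inj/lift_perm_inj.
(* Here the last letter, 0 or [n.+1], separates the images. *)
- move=> s t st; have := letter_add_min_last s.
  by rewrite st letter_add_min_max_last.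
- by move=> s; apply: (eq_avoiders mP) => p; apply: contains_add_min.
- by move=> s; apply: (eq_avoiders mP) => p; apply: contains_add_min_max.
move=> pi; rewrite inE => /avP[p123 p132 p312].
have [l1|[l0 l1]] := avoids_min_last p123 p132 p312; [left|right].
  apply: lift_perm_surj; apply: val_inj.
  by rewrite /= -letter_ord.
have [|s sE] := @lift_perm_surj _ ord_max ord_max pi.
  by apply: val_inj; rewrite /= -letter_ord.
have [|t tE] := @lift_perm_surj _ ord_max ord0 s; last by exists t; rewrite sE tE.
apply: val_inj => /=; rewrite -letter_ord /=.
have := letter_lift_perm ord_max ord_max s (ltnSn n).
by rewrite -sE /bump /= ltnn l0; lia.
Qed.

(** * The Fibonacci recurrence and the four sets *)

Lemma card_avoiders_fib (F : nat -> nat) P :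
    F 1 = 1 -> F 2 = 2 ->
    (forall n, 3 <= n -> F n = F (n - 1) + F (n - 2)) ->
    (forall n, #|avoiders n.+2 P| = #|avoiders n.+1 P| + #|avoiders n P|) ->
  forall n, 1 <= n -> #|avoiders n P| = F n.
Proof.
move=> F1 F2 Frec Prec [//|n _].
suff [] : #|avoiders n.+1 P| = F n.+1 /\ #|avoiders n.+2 P| = F n.+2 by [].
(* The count for size 2 comes from the recurrence at 0, as the sum 1 + 1 of the counts for sizes 1
   and 0. *)
elim: n => [|n [IH1 IH2]]; first by rewrite F1 F2 Prec !card_avoiders_le1.
by split=> //; rewrite Prec IH1 IH2 (Frec n.+3) // !subSS !subn0.
Qed.

Theorem mainTheorem16 (F : nat -> nat)
  (F1 : F 1 = 1) (F2 : F 2 = 2)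
  (Frec : forall n : nat, 3 <= n -> F n = F (n - 1) + F (n - 2)) :
  forall n : nat, 1 <= n ->
  [/\ #|avoiders n [:: [gp 1-2 3]; [gp 2-1 3]; [gp 1-3 2]; [gp 2 1-3]; [gp 1 2-3]]| = F n,
      #|avoiders n [:: [gp 1-2 3]; [gp 2-1 3]; [gp 1 3-2]; [gp 2 1-3]; [gp 1 2-3]]| = F n,
      #|avoiders n [:: [gp 1-2 3]; [gp 2-1 3]; [gp 1 3-2]; [gp 1-3 2]; [gp 2 1-3]]| = F n
    & #|avoiders n [:: [gp 1-2 3]; [gp 1 3-2]; [gp 3 1-2]; [gp 3-1 2]; [gp 1-3 2]]| = F n].
Proof.
move=> n n0; split; apply: card_avoiders_fib n0 => // {}n.
(* The first three sets each begin with 1-23, 2-13 and a dashed form of 132. *)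
- by apply: card_avoiders_max => // pi /and5P[-> -> ->].
- by apply: card_avoiders_max => // pi /and5P[-> -> ->]; rewrite orbT.
- by apply: card_avoiders_max => // pi /and5P[-> -> ->]; rewrite orbT.
- by apply: card_avoiders_min => // pi /and5P[-> _ _ -> /andP[->]].
Qed.
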